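(* Let $\alpha_1,\ldots,\alpha_k\in[0,\pi)$ be irrational directions. There exists an infinite measure preserving, recurrent, and ergodic $\mathbb Z^2$ action $(X,\mu,\{T^{\vec n}\}_{\vec n\in\mathbb Z^2})$ on a $\sigma$-finite Lebesgue space with the property that $\mathcal R_T$ contains all rational directions but $\alpha_i\notin\mathcal R_T$ for $i=1,\ldots,k$.
   Context: Infinite measure preserving means the maps $T^{\vec n}$ are invertible, measurable and $\mu$-preserving, with $\mu(X)=\infty$. The $\mathbb Z^2$ action is recurrent if for every measurable set $A$ with $\mu(A)>0$ there exists $\vec n\in\mathbb Z^2$, $\vec n\neq\vec 0$, such that $\mu(A\cap T^{\vec n}A)>0$. A direction is an angle $\theta\in[0,\pi)$. It is rational if some non-zero real multiple of $(\cos\theta,\sin\theta)$ lies in $\mathbb Z^2$, and irrational otherwise. For $\epsilon>0$ the $\epsilon$-tunnel of $\theta$ is $\bigcup_{t\in\mathbb R}B_\epsilon(t(\cos\theta,\sin\theta))$, where $B_\epsilon(\vec x)$ is the $\epsilon$-ball around $\vec x\in\mathbb R^2$. A direction $\theta$ is recurrent for $T$ if for all $\epsilon>0$ and all measurable sets $A$ with $\mu(A)>0$ there is a non-zero vector $\vec n\in\mathbb Z^2$ in the $\epsilon$-tunnel of $\theta$ such that $\mu(A\cap T^{\vec n}A)>0$. $\mathcal R_T\subset[0,\pi)$ denotes the set of recurrent directions. *)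

(* Defs.v *)
From HB Require Import structures.
From mathcomp Require Import all_boot all_order all_algebra.
From mathcomp Require Import all_classical all_reals all_analysis.

Set Implicit Arguments.
Unset Strict Implicit.
Unset Printing Implicit Defensive.

Import Order.TTheory GRing.Theory Num.Theory.
Import numFieldNormedType.Exports.

Local Open Scope classical_set_scope.
Local Open Scope ring_scope.

Notation Z2 := (int * int)%type.

(* The real line with the sigma-algebra of Lebesgue measurable sets, that is,
   the domain of completed_lebesgue_measure (the library's lebesgue_measure
   lives on the Borel sets). *)
Notation lebesgueTypeR R := (caratheodory_type (@wlength R idfun)^*%mu).

(* A Lebesgue space in the sense of Rokhlin, with a possibly infinite measure:
   a complete measure space isomorphic mod 0 to an interval of R with Lebesgue
   measure together with countably many atoms.  D is the set of atoms, and f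
   restricts to an isomorphism from X0 onto Y0, a subset of full measure of the
   interval I; X0 and D together have full measure.  The interval may be empty
   or unbounded. *)
Definition lebesgue_space (R : realType) d (X : measurableType d)
    (mu : {measure set X -> \bar R}) : Prop :=
  measure_is_complete mu /\
  exists (D X0 : set X) (I : interval R) (Y0 : set (lebesgueTypeR R))
    (f : X -> lebesgueTypeR R),
    [/\ countable D,
        (forall x, D x -> measurable [set x] /\ (0 < mu [set x] < +oo)%E),
        [/\ measurable X0, X0 `&` D = set0 & mu (~` (X0 `|` D)) = 0%E],
        [/\ measurable Y0, Y0 `<=` [set` I] &
            completed_lebesgue_measure ([set` I] `\` Y0) = 0%E] &
        [/\ set_bij X0 Y0 f,
            (forall A, A `<=` X0 -> measurable A <-> measurable (f @` A)) &
            (forall A, A `<=` X0 -> measurable A ->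
               mu A = completed_lebesgue_measure (f @` A))]].

Definition Z2_action (X : Type) (T : Z2 -> X -> X) : Prop :=
  (forall x, T 0 x = x) /\ (forall m n x, T (m + n) x = T m (T n x)).

Definition measure_preserving (R : realType) d (X : measurableType d)
    (mu : {measure set X -> \bar R}) (S : X -> X) : Prop :=
  measurable_fun setT S /\
  forall A, measurable A -> mu (S @^-1` A) = mu A.

(* Invertibility of the maps T n is part of Z2_action, with inverse T (- n). *)
Definition infinite_measure_preserving_action (R : realType) d
    (X : measurableType d) (mu : {measure set X -> \bar R})
    (T : Z2 -> X -> X) : Prop :=
  [/\ Z2_action T, (forall n, measure_preserving mu (T n)) &
      mu setT = +oo%E].

Definition recurrent_action (R : realType) d (X : measurableType d)
    (mu : {measure set X -> \bar R}) (T : Z2 -> X -> X) : Prop :=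
  forall A, measurable A -> (0 < mu A)%E ->
    exists n : Z2, n != 0 /\ (0 < mu (A `&` T n @` A))%E.

(* `+` is the symmetric difference of sets. *)
Definition ergodic_action (R : realType) d (X : measurableType d)
    (mu : {measure set X -> \bar R}) (T : Z2 -> X -> X) : Prop :=
  forall A, measurable A -> (forall n, mu (A `+` T n @` A) = 0%E) ->
    mu A = 0%E \/ mu (~` A) = 0%E.

Definition direction (R : realType) (theta : R) : Prop := 0 <= theta < pi.

Definition rational_direction (R : realType) (theta : R) : Prop :=
  direction theta /\
  exists c : R, c != 0 /\ exists n : Z2,
    c * cos theta = n.1%:~R /\ c * sin theta = n.2%:~R.

Definition irrational_direction (R : realType) (theta : R) : Prop :=
  direction theta /\ ~ rational_direction theta.

(* The library's ball on R * R is the one of the sup norm. *)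
Definition euclidean_ball (R : realType) (eps : R) (x : R * R) : set (R * R) :=
  [set y | Num.sqrt ((y.1 - x.1) ^+ 2 + (y.2 - x.2) ^+ 2) < eps].

Definition tunnel (R : realType) (eps theta : R) : set (R * R) :=
  \bigcup_(t in [set: R]) euclidean_ball eps (t * cos theta, t * sin theta).

Definition recurrent_directions (R : realType) d (X : measurableType d)
    (mu : {measure set X -> \bar R}) (T : Z2 -> X -> X) : set R :=
  [set theta | direction theta /\
    forall eps : R, 0 < eps ->
    forall A, measurable A -> (0 < mu A)%E ->
    exists n : Z2, [/\ n != 0, tunnel eps theta (n.1%:~R, n.2%:~R) &
                       (0 < mu (A `&` T n @` A))%E]].

(* Main.v *)
(* The action is a rank-one cutting-and-stacking construction on the real line
   with completed Lebesgue measure.  At stage n the dyadic cells of length 2^-n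
   carry distinct addresses in Z^2, finitely many of them being frozen, and
   T^g translates the frozen cell with address a onto the frozen cell with
   address a + g.  To pass to the next stage, each frozen cell is halved and its
   right half gets the address a + w_n, where w_n is a long multiple of an
   integer vector v_n; new cells are then added so that T^g is eventually defined
   at every point.
   Every non-zero v occurs infinitely often as v_n, and w_n carries left halves to
   right halves, so a density argument shows that all rational directions are
   recurrent; moving one dense cell to another one gives ergodicity.  The return
   vectors of the cell [0, 1) are the sums of e_i w_i with e_i in {-1, 0, 1}.
   Irrational lines meet no non-zero integer vector, hence when w_n is long
   enough compared to w_0, ..., w_(n-1) the sums with last term +- w_n stay at
   distance at least 1 from the lines of direction alpha_i. *)
Require Import Defs.
From HB Require Import structures.
From mathcomp Require Import all_boot all_order all_algebra.
From mathcomp Require Import all_classical all_reals all_analysis.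
From mathcomp Require Import zify ring lra.

Set Implicit Arguments.
Unset Strict Implicit.
Unset Printing Implicit Defensive.

Import Order.TTheory GRing.Theory Num.Theory.
Import numFieldNormedType.Exports.

Local Open Scope classical_set_scope.
Local Open Scope ring_scope.

Local Notation clm := completed_lebesgue_measure.

(** * Translation invariance of completed Lebesgue measure *)

Lemma clm_itv_measurable {R : realType} (i : interval R) :
  measurable ([set` i] : set (lebesgueTypeR R)).
Proof. by apply: sub_caratheodory; exact: measurable_itv. Qed.

Lemma clm_itvco {R : realType} (a b : R) : a <= b ->
  clm (`[a, b[%classic : set R) = (b - a)%:E.
Proof.
move=> ab; transitivity (@lebesgue_measure R `[a, b[%classic) => //.
rewrite lebesgue_measure_itv /= lte_fin.
by case: ltgtP ab => // -> _; rewrite subrr.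
Qed.

Definition translate_set {R : realType} (c : R) (A : set R) : set R :=
  [set x | A (x + c)].

Lemma translate_setK {R : realType} (c : R) (A : set R) :
  translate_set (- c) (translate_set c A) = A.
Proof. by apply/seteqP; split=> x; rewrite /translate_set /= subrK. Qed.

Lemma translate_set_itvoc {R : realType} (c a b : R) :
  translate_set c `]a, b] = `](a - c), (b - c)]%classic.
Proof.
by apply/seteqP; split=> x; rewrite /translate_set /= !in_itv /= ltrBlDr lerBrDr.
Qed.

(** Translating a cover by half-open intervals preserves its total length, so the infimum over
    covers cannot grow. *)
Lemma clm_translate_set_le {R : realType} (c : R) (A : set R) :
  (clm (translate_set c A) <= clm A)%E.
Proof.
apply: le_ereal_inf_tmp => _ [F [mF AF] <-]; apply: ereal_inf_lbound.
exists (fun k => translate_set c (F k)).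
  split=> [k|x /AF[k _ Fk]]; last by exists k.
  have [[a b] _ <-] := mF k; exists (a - c, b - c) => //=.
  by rewrite translate_set_itvoc.
apply: eq_eseriesr => k _; have [[a b] _ <-] := mF k.
rewrite /= translate_set_itvoc !wlength_itv /= !lte_fin ltrD2r -!EFinB.
by case: ifP => // _; congr (_%:E); ring.
Qed.

Lemma clm_translate_set {R : realType} (c : R) (A : set R) :
  clm (translate_set c A) = clm A.
Proof.
apply/eqP; rewrite eq_le clm_translate_set_le /= -{1}(translate_setK c A).
exact: clm_translate_set_le.
Qed.

(** Measurability here is the Caratheodory criterion: splitting [X] along [translate_set c A]
    amounts to splitting [translate_set (- c) X] along [A]. *)
Lemma measurable_translate_set {R : realType} (c : R) (A : set (lebesgueTypeR R)) :
  measurable A -> measurable (translate_set c A : set (lebesgueTypeR R)).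
Proof.
move=> mA; have {}mA : ((@wlength R idfun)^*%mu).-caratheodory A := mA.
change (((@wlength R idfun)^*%mu).-caratheodory (translate_set c A)) => X.
have := mA (translate_set (- c) X).
have E B : (@wlength R idfun)^*%mu (translate_set (- c) B) = (@wlength R idfun)^*%mu B.
  exact (@clm_translate_set R (- c) B).
rewrite E => ->; rewrite -(E (X `&` translate_set c A)) -(E (X `&` ~` translate_set c A)).
congr (_ + _)%E; congr (mu_ext _ _); apply/seteqP; split=> x;
  by rewrite /translate_set /= ?subrK.
Qed.

(** The preimage of [A] splits along the [P i], and [A] itself along their images, which are
    disjoint since [S] is injective; corresponding pieces are translates. *)
Lemma translations_preserve {R : realType} (S S' : R -> R) (h : nat -> R)
    (P : nat -> set (lebesgueTypeR R)) :
  cancel S S' -> cancel S' S ->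
  (forall i, measurable (P i)) -> trivIset setT P -> \bigcup_i P i = setT ->
  (forall i x, P i x -> S x = x + h i) ->
  measure_preserving (@clm R) (S : lebesgueTypeR R -> lebesgueTypeR R).
Proof.
move=> SK S'K mP tP PT SP.
have preE (A : set R) : S @^-1` A = \bigcup_i (P i `&` translate_set (h i) A).
  apply/seteqP; split=> [x Ax|x [i _ [Px]]]; last by rewrite /translate_set /= -SP.
  have [i _ Pix] : (\bigcup_i P i) x by rewrite PT.
  by exists i => //; split => //; rewrite /translate_set /= -SP.
have AE (A : set R) : A = \bigcup_i (translate_set (- h i) (P i) `&` A).
  apply/seteqP; split=> [x Ax|x [i _ []]//].
  have [i _ Pix] : (\bigcup_i P i) (S' x) by rewrite PT.
  by exists i => //; split => //; rewrite /translate_set /= -{1}(S'K x) (SP i)// addrK.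
have tI (A : set R) : trivIset setT (fun i => translate_set (- h i) (P i) `&` A).
  move=> i j _ _ [x [[+ _] [+ _]]]; rewrite /translate_set /= => Pi Pj.
  apply: tP => //; exists (x - h i); split=> //.
  suff -> : x - h i = x - h j by [].
  by apply: (can_inj SK); rewrite (SP i)// (SP j)// !subrK.
have mI (A : set (lebesgueTypeR R)) i :
    measurable A -> measurable (P i `&` translate_set (h i) A : set (lebesgueTypeR R)).
  by move=> mA; apply: measurableI => //; exact: measurable_translate_set.
split=> [_ A mA|A mA].
  by rewrite setTI preE; apply: bigcupT_measurable => i; exact: mI.
rewrite preE [in RHS](AE A) !measure_bigcup //=.
- apply: eq_eseriesr => i _; rewrite -(clm_translate_set (h i) (_ `&` A)).
  congr (clm _); apply/seteqP; split=> x; rewrite /translate_set /= addrK//.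
- by move=> i _; apply: measurableI => //; exact: measurable_translate_set.
- by move=> i _; exact: mI.
- by move=> i j _ _ [x [[+ _] [+ _]]] => Pi Pj; apply: tP => //; exists x.
Qed.

(** * Dyadic cells and density *)

(* Level-n cells are the dyadic intervals [j/2^n, (j+1)/2^n). *)
Definition idx {R : realType} (n : nat) (x : R) : int := Num.floor (x * 2 ^+ n).

Definition cell {R : realType} (n : nat) (j : int) : set R := [set x | idx n x = j].

Lemma cellP {R : realType} n j (x : R) :
  cell n j x <-> j%:~R / 2 ^+ n <= x < (j%:~R + 1) / 2 ^+ n.
Proof.
rewrite /cell /idx /= ler_pdivrMr ?exprn_gt0// ltr_pdivlMr ?exprn_gt0//.
split=> [<-|h]; last by apply: floor_def; rewrite intrD.
by have := floor_itv (x * 2 ^+ n); rewrite intrD.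
Qed.

Lemma cellE {R : realType} n j :
  cell n j = `[j%:~R / 2 ^+ n, (j%:~R + 1) / 2 ^+ n[%classic :> set R.
Proof.
by apply/seteqP; split=> x /=; rewrite in_itv /= => /cellP.
Qed.

Lemma measurable_cell {R : realType} n j :
  measurable (cell n j : set (lebesgueTypeR R)).
Proof. by rewrite cellE; exact: clm_itv_measurable. Qed.

Lemma clm_cell {R : realType} n j : clm (@cell R n j) = ((2 ^+ n)^-1)%:E.
Proof.
rewrite cellE clm_itvco; first by congr _%:E; ring.
by rewrite ler_pM2r ?invr_gt0 ?exprn_gt0// lerDl.
Qed.

(** At most [(b - a) * 2 ^ n + 2] cells meet []a, b]]; the term [3 / 2 / 2 ^ n] pays for the two
    extra ones. *)
Lemma clm_sparse_itvoc {R : realType} (A : set R) (n : nat) (a b : R) : a <= b ->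
  (forall j, clm (A `&` cell n j) <= (3 / 4 / 2 ^+ n)%:E)%E ->
  (clm (A `&` `]a, b]) <= (3 / 4 * (b - a) + 3 / 2 / 2 ^+ n)%:E)%E.
Proof.
move=> ab Acell; pose N := `|idx n b - idx n a|%N.+1.
have p2 : 0 < 2 ^+ n :> R by rewrite exprn_gt0.
have iab : idx n a <= idx n b by rewrite /idx le_floor// ler_wpM2r// ltW.
pose F (i : nat) := A `&` cell n (idx n a + i%:Z) `&` `]a, b].
have -> : A `&` `]a, b] = \big[setU/set0]_(i < N) F i.
  rewrite -(bigcup_mkord N F).
  apply/seteqP; split=> [x [Ax xab]|x [i _ [[Ax _] xab]]]//.
  move: (xab); rewrite /= in_itv /= => /andP[ax xb].
  have iax : idx n a <= idx n x by rewrite /idx le_floor// ler_wpM2r// ltW.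
  have ixb : idx n x <= idx n b by rewrite /idx le_floor// ler_wpM2r// ltW.
  exists `|idx n x - idx n a|%N; first by rewrite /N /=; lia.
  by split => //; split => //; rewrite /cell /=; lia.
apply: (le_trans (outer_measure_subadditive _ _ _)).
apply: (@le_trans _ _ (\sum_(i < N) (3 / 4 / 2 ^+ n)%:E)%E).
  apply: lee_sum => i _; apply: le_trans (Acell (idx n a + i%:Z)).
  by apply: le_outer_measure; exact: subIsetl.
rewrite sumEFin lee_fin sumr_const card_ord -[_ *+ N]mulr_natl.
have NE : N%:R = (idx n b)%:~R - (idx n a)%:~R + 1 :> R.
  have d0 : 0 <= idx n b - idx n a by rewrite subr_ge0.
  by rewrite /N -natr1 -rmorphB /= -(gez0_abs d0).
have h1 : (idx n b)%:~R / 2 ^+ n <= b by rewrite ler_pdivrMr//; exact: floor_le.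
have h2 : a <= ((idx n a)%:~R + 1) / 2 ^+ n.
  by rewrite ler_pdivlMr// ltW//; have := floorD1_gt (a * 2 ^+ n); rewrite intrD.
rewrite {}NE; move: h1 h2; set q := _^-1; move=> h1 h2; nra.
Qed.

(* A weak form of Lebesgue's density theorem: covers of A by intervals would
   otherwise give clm A <= 3/4 clm A. *)
Lemma clm_sparse {R : realType} (A : set R) : (clm A < +oo)%E ->
  (forall n0, exists2 n, (n0 <= n)%N &
     forall j, clm (A `&` cell n j) <= (3 / 4 / 2 ^+ n)%:E)%E -> clm A = 0%E.
Proof.
move=> Afin Asp.
(* Sparse levels are arbitrarily fine, so the boundary term tends to 0. *)
have Aitv a b : a <= b -> (clm (A `&` `]a, b]) <= (3 / 4 * (b - a))%:E)%E.
  move=> ab; apply/lee_addgt0Pr => e e0.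
  have [n0 n0P] : exists n0, forall n, (n0 <= n)%N -> (3 / 2 / 2 ^+ n) < e.
    exists (Num.bound (3 / 2 / e)) => n nn.
    by rewrite ltr_pdivrMr ?exprn_gt0// -ltr_pdivrMl// mulrC (upper_nthrootP nn).
  have [n nn Acell] := Asp n0.
  apply: (le_trans (clm_sparse_itvoc ab Acell)).
  by rewrite -EFinD lee_fin lerD2l ltW// n0P.
have A0 : (0 <= clm A)%E by exact: outer_measure_ge0.
have : (clm A * (4 / 3)%:E <= clm A)%E.
  rewrite [leRHS]/clm; apply: le_ereal_inf_tmp => _ [F [mF AF] <-].
  rewrite -lee_pdivlMr//.
  have -> : A = \bigcup_k (A `&` F k) by rewrite -setI_bigcupr; apply/esym/setIidl.
  apply: (le_trans (outer_measure_sigma_subadditive _ _)).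
  rewrite muleC -nneseriesZl; last first.
    by move=> i _; exact: wlength_ge0.
  apply: lee_nneseries => [k _ _|k _]; first exact: outer_measure_ge0.
  have [[a b] _ <-] := mF k; rewrite /= wlength_itv /= lte_fin.
  have [ab|ba] := ltP a b.
    apply: (le_trans (Aitv _ _ (ltW ab))).
    by rewrite -EFinB -EFinM lee_fin; lra.
  by rewrite set_itv_ge ?setI0 ?outer_measure0 ?mule0// -leNgt.
move: A0 Afin; case: (clm A) => [r| |]//; rewrite lee_fin => r0 _.
by rewrite -EFinM lee_fin => rr; congr _%:E; lra.
Qed.

(** Some bounded window [I k] meets [A] in positive finite measure, so by [clm_sparse] no level from
    some [n0] on is sparse. The window bounds the index [j]. *)
Lemma dense_cell {R : realType} (A : set R) : (0 < clm A)%E ->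
  exists k n0 : nat, forall n, (n0 <= n)%N -> exists2 j : int,
    - (k * 2 ^ n)%N%:Z <= j < (k * 2 ^ n)%N%:Z &
    ((3 / 4 / 2 ^+ n)%:E < clm (A `&` cell n j))%E.
Proof.
move=> A0; pose I k := `[- k%:R, k%:R[%classic : set R.
have [k Ak] : exists k, (0 < clm (A `&` I k))%E.
  apply: contrapT => /forallNP AN; move: A0; apply/negP; rewrite -leNgt.
  have -> : A = \bigcup_k (A `&` I k).
    rewrite -setI_bigcupr; apply/esym/setIidl => x _.
    have := archi_boundP (normr_ge0 x); rewrite ltr_norml => /andP[/ltW x1 x2].
    by exists (Num.bound `|x|) => //; rewrite /I /= in_itv /= x1.
  apply: (le_trans (outer_measure_sigma_subadditive _ _)).
  rewrite eseries0// => i _ _; apply/eqP; rewrite eq_le outer_measure_ge0 andbT.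
  by rewrite leNgt; apply/negP/AN.
exists k.
have [n0 n0P] : exists n0, forall n, (n0 <= n)%N -> exists j,
    ((3 / 4 / 2 ^+ n)%:E < clm (A `&` I k `&` cell n j))%E.
  apply: contrapT => /forallNP AN; move: Ak; rewrite (_ : clm _ = 0%E) ?ltxx//.
  apply: clm_sparse.
    apply: (@le_lt_trans _ _ (clm (I k))).
      by apply: le_outer_measure; exact: subIsetr.
    rewrite clm_itvco ?ltry//.
    by rewrite (@le_trans _ _ 0)// oppr_le0.
  move=> n0; have /existsNP[n /not_implyP[nn /forallNP nP]] := AN n0.
  by exists n => // j; rewrite leNgt; apply/negP.
exists n0 => n /n0P[j jP]; exists j; last first.
  by apply: (lt_le_trans jP); apply: le_outer_measure => x [[]].
have [x [[Ax]]] : (A `&` I k `&` cell n j) !=set0.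
  apply/set0P/eqP => E; move: jP; rewrite E measure0 lte_fin.
  by apply/negP; rewrite -leNgt !divr_ge0// exprn_ge0.
have p2 : 0 < 2 ^+ n :> R by rewrite exprn_gt0.
have kE : (k * 2 ^ n)%N%:~R = k%:R * 2 ^+ n :> R by rewrite PoszM intrM -natrX.
rewrite /I /= in_itv /= => /andP[x1 x2] <-; rewrite /idx floor_ge_int floor_lt_int.
by rewrite rmorphN /= kE -mulNr ler_pM2r// ltr_pM2r// x1.
Qed.

(** * Bijections from Z to Z^2 with finitely many prescribed values *)

Lemma infinite_range (T : Type) (e : nat -> T) : injective e -> infinite_set [set: T].
Proof.
move=> ei Tfin; apply: infinite_nat; rewrite -(preimage_setT e).
by apply: finite_preimage Tfin => x y _ _ /ei.
Qed.

Lemma bij_nat (T : countType) (e : nat -> T) : injective e ->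
  exists f : T -> nat, bijective f.
Proof.
move=> ei; have Tn : ([set: T] #= [set: nat])%card.
  by apply: eq_card_nat; [exact: countableP|exact: infinite_range ei].
have /card_set_bijP[f fb] := Tn.
by exists f; rewrite -setTT_bijective.
Qed.

Lemma bij_int_Z2 : exists h : int -> Z2, bijective h.
Proof.
have [f fb] := @bij_nat int Posz (fun x y => @congr1 _ _ absz (Posz x) (Posz y)).
have [g [g' gK g'K]] := @bij_nat Z2 (fun n => (Posz n, 0))
  (fun x y => @congr1 _ _ (fun z : Z2 => absz z.1) (Posz x, 0) (Posz y, 0)).
exists (g' \o f); apply: bij_comp fb; by exists g.
Qed.

(* Correct a bijection at one point at a time by composing with a transposition. *)
Lemma extend_bij (s : seq int) (p : int -> Z2) : {in s &, injective p} ->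
  exists Phi : int -> Z2, bijective Phi /\ {in s, Phi =1 p}.
Proof.
elim: s => [|j s IH] pinj.
  have [h hb] := bij_int_Z2.
  by exists h.
have [|Phi [Phib PhiE]] := IH.
  by move=> x y xs ys; apply: pinj; rewrite inE ?xs ?ys orbT.
have [js|js] := boolP (j \in s).
  by exists Phi; split => // i; rewrite inE => /predU1P[->|]; exact: PhiE.
pose sw z := if z == Phi j then p j else if z == p j then Phi j else z.
have swK : involutive sw.
  move=> z; rewrite /sw; have [->|zj] := eqVneq z (Phi j).
    by have [//|e] := eqVneq (p j) (Phi j); rewrite eqxx.
  have [->|zp] := eqVneq z (p j); first by rewrite eqxx.
  by rewrite (negbTE zj) (negbTE zp).
exists (sw \o Phi); split; first exact: (bij_comp (inv_bij swK) Phib).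
move=> i; rewrite inE => /predU1P[->|is_] /=; first by rewrite /sw eqxx.
have ij : i != j by apply: contraNneq js => <-.
rewrite PhiE// /sw -PhiE// (inj_eq (bij_inj Phib)) (negbTE ij) PhiE//.
rewrite (_ : p i == p j = false)//; apply: contraNF ij => /eqP/pinj -> //.
  by rewrite inE is_ orbT.
by rewrite inE eqxx.
Qed.

(** * Stages and their refinement *)

Definition frozen (M : nat) (j : int) := - M%:Z <= j < M%:Z.

Lemma frozen_seq (M : nat) : exists s : seq int, s =i frozen M.
Proof.
exists [seq i%:Z - M%:Z | i <- iota 0 (M + M)] => j.
rewrite unfold_in /frozen; apply/mapP/idP => [[i]|h].
  by rewrite mem_iota => ? ->; lia.
by exists (absz (j + M%:Z)); rewrite ?mem_iota; move: h; rewrite unfold_in; lia.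
Qed.

Lemma seq_frozen (s : seq int) : exists M : nat, {in s, forall j, frozen M j}.
Proof.
elim: s => [|j s [M sM]]; first by exists 0%N.
exists (M + `|j|.+1)%N => i; rewrite inE => /predU1P[->|/sM]; rewrite /frozen; lia.
Qed.

(* [address] names every cell of the current level by a vector of Z^2; only the
   cells j with -extent <= j < extent are final, the remaining values are
   arbitrary and may change at the next stage. *)
Record stage := Stage {
  address : int -> Z2;
  position : Z2 -> int;
  extent : nat;
  addressK : cancel address position;
  positionK : cancel position address }.

(* Each frozen cell j with address a is cut into a left half, which keeps the
   address a, and a right half, which gets a + w.  The fourth clause makes the
   translations by the first n vectors eventually defined everywhere; the last
   one keeps the new return vectors out of [bad]. *)
Definition refines (bad : Z2 -> Prop) (n : nat) (v : Z2) (s s' : stage) (w : Z2) :=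
  [/\ exists c : nat, w = v *+ c.+1,
      forall j (b : bool), frozen (extent s) j ->
        address s' (2 * j + b%:Z) = address s j + w *+ b,
      (2 * extent s + n.+1 * 2 ^ n.+1 <= extent s')%N,
      forall j g, frozen (2 * extent s) j -> (pickle g < n)%N ->
        frozen (extent s') (position s' (address s' j + g)) &
      forall i j, frozen (extent s) i -> frozen (extent s) j ->
        ~ bad (address s i - address s j + w)].

(** Irrationality of the directions enters the construction in this form; [D] will be the
    differences of frozen addresses. *)
Definition escapes (bad : Z2 -> Prop) := forall v : Z2, v != 0 -> forall D : seq Z2,
  exists c : nat, forall d : Z2, d \in D -> ~ bad (d + v *+ c.+1).

(** Since 0 is bad, a [w] keeping all differences of frozen addresses out of [bad] also keeps the
    addresses of the half cells distinct, so they extend to a bijection. The extent is chosen last,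
    large enough for the finitely many images required. *)
Lemma exists_refinement (bad : Z2 -> Prop) (n : nat) (v : Z2) (s : stage) :
  bad 0 -> escapes bad -> v != 0 -> exists s' w, refines bad n v s s' w.
Proof.
move=> bad0 esc v0; pose M := extent s.
have [J JE] := frozen_seq M.
have [c cP] := esc v v0 [seq address s i - address s j | i <- J, j <- J].
set w := v *+ c.+1 in cP.
have wbad i j : frozen M i -> frozen M j -> ~ bad (address s i - address s j + w).
  by move=> Mi Mj; apply: cP; apply: allpairs_f; rewrite JE.
(* Even indices are left halves, odd ones right halves. *)
pose p j := address s (j %/ 2)%Z + w *+ (j %% 2 == 1)%Z.
have [J2 J2E] := frozen_seq (2 * M).
have frozen2 j : frozen (2 * M) j -> frozen M (j %/ 2)%Z.
  by rewrite /frozen => h; lia.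
have [Phi [[Psi PhiK PsiK] PhiE]] : exists Phi, bijective Phi /\ {in J2, Phi =1 p}.
  apply: extend_bij => i j; rewrite !J2E => /frozen2 i2 /frozen2 j2.
  rewrite /p; have [ei|ei] := eqVneq (i %% 2)%Z 1; have [ej|ej] := eqVneq (j %% 2)%Z 1.
  - by move=> /addIr/(can_inj (@addressK s)); lia.
  - move=> /eqP; rewrite addr0 -subr_eq0 addrAC => /eqP e.
    by case: (wbad _ _ i2 j2); rewrite e.
  - move=> /esym/eqP; rewrite addr0 -subr_eq0 addrAC => /eqP e.
    by case: (wbad _ _ j2 i2); rewrite e.
  - by rewrite !addr0 => /(can_inj (@addressK s)); lia.
have [B BP] := seq_frozen
  [seq Psi (Phi j + g) | j <- J2, g <- pmap unpickle (iota 0 n)].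
pose s' := Stage (2 * M + n.+1 * 2 ^ n.+1 + B) PhiK PsiK.
exists s', w; split=> //=.
- by exists c.
- move=> j b Mj; rewrite PhiE; last first.
    by rewrite J2E; move: Mj; rewrite unfold_in /frozen -/M; case: b; lia.
  rewrite /p (_ : (_ %/ 2)%Z = j); last by case: b; lia.
  by congr (_ + _ *+ _); case: b; lia.
- by rewrite leq_addr.
- move=> j g Mj gn; have : frozen B (Psi (Phi j + g)).
    apply: BP; apply: allpairs_f; first by rewrite J2E.
    by rewrite mem_pmap; apply/mapP; exists (pickle g); rewrite ?mem_iota ?pickleK.
  by rewrite /frozen; lia.
Qed.

(* Through the 2-adic valuation of n + 1, every non-zero vector is visited
   infinitely often. *)
Definition visit (n : nat) : Z2 :=
  if (unpickle (logn 2 n.+1) : option Z2) is Some v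
  then if v == 0 then (1, 0) else v else (1, 0).

Lemma visit_neq0 n : visit n != 0.
Proof. by rewrite /visit; case: unpickle => // v; case: (eqVneq v 0). Qed.

Lemma visit_recurrent (v : Z2) (n0 : nat) : v != 0 ->
  exists2 n, (n0 <= n)%N & visit n = v.
Proof.
(* The odd factor makes the index at least [n0] without changing the valuation [pickle v]. *)
move=> v0; pose m := (2 ^ pickle v * (2 * n0).+1)%N.
have m0 : (0 < m)%N by rewrite muln_gt0 expn_gt0.
exists m.-1.
  rewrite /m; have : (0 < 2 ^ pickle v)%N by rewrite expn_gt0.
  by case: (2 ^ pickle v)%N => // k _; rewrite mulSn; lia.
rewrite /visit prednK// /m lognM ?expn_gt0// pfactorK//.
rewrite (@logn_coprime 2 (2 * n0).+1); last by rewrite coprime2n /= oddM.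
by rewrite addn0 pickleK (negbTE v0).
Qed.

Lemma exists_tower (bad : Z2 -> Prop) : bad 0 -> escapes bad ->
  exists (s : nat -> stage) (w : nat -> Z2),
    (0 < extent (s 0))%N /\
    forall n, refines bad n (visit n) (s n) (s n.+1) (w n).
Proof.
move=> bad0 esc; have [h [h' hK h'K]] := bij_int_Z2.
(* The stage number is carried along because the relation iterated by [dependent_choice] does not
   see the step. *)
pose next (x y : nat * stage) :=
  y.1 = x.1.+1 /\ exists w, refines bad x.1 (visit x.1) x.2 y.2 w.
have [|f [f0 fS]] := @dependent_choice _ next _ (0%N, Stage 1 hK h'K).
  move=> [n s]; apply: cid.
  have [s' [w sw]] := exists_refinement n s bad0 esc (visit_neq0 n).
  by exists (n.+1, s'); split => //=; exists w.
have f1 n : (f n).1 = n.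
  by elim: n => [|n IH]; [rewrite f0|have [-> _] := fS n; rewrite IH].
have /choice[w wP] n : exists w, refines bad n (visit n) (f n).2 (f n.+1).2 w.
  by have [_ [w]] := fS n; rewrite f1 => ?; exists w.
by exists (fun n => (f n).2), w; rewrite f0.
Qed.

(** * Translations of cells at one stage, and passage to the next *)

Section stage_translation.
Context {R : realType}.
Implicit Types (s : stage) (x : R) (g h : Z2).

Definition image_cell s g (j : int) : int := position s (address s j + g).

Definition translate s n g x : R :=
  x + (image_cell s g (idx n x) - idx n x)%:~R / 2 ^+ n.

(** On such cells the translation is final; elsewhere it is provisional. *)
Definition stable s g (j : int) : bool :=
  frozen (extent s) j && frozen (extent s) (image_cell s g j).

Lemma idxD n x (d : int) : idx n (x + d%:~R / 2 ^+ n) = idx n x + d.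
Proof.
rewrite /idx mulrDl divfK ?expf_neq0// floorDrz ?intr_int//.
by rewrite intrKfloor.
Qed.

Lemma idxS n x : exists b : bool, idx n.+1 x = 2 * idx n x + b%:Z.
Proof.
have /andP[h1 h2] := floor_itv (x * 2 ^+ n).
have /andP[h3 h4] := floor_itv (x * 2 ^+ n.+1).
rewrite /idx; set i := Num.floor _ in h1 h2 *; set j := Num.floor _ in h3 h4 *.
have E : x * 2 ^+ n.+1 = 2 * (x * 2 ^+ n) by rewrite exprS; ring.
have i1 : 2 * i < j + 1.
  by rewrite -(ltr_int R) rmorphM /=; apply: le_lt_trans h4; rewrite E; lra.
have i2 : j < 2 * i + 2.
  rewrite -(ltr_int R); apply: (le_lt_trans h3).
  by move: h2; rewrite E !rmorphD /= rmorphM /=; lra.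
by exists (j == 2 * i + 1); case: eqP; lia.
Qed.

Lemma idx_translate s n g x : idx n (translate s n g x) = image_cell s g (idx n x).
Proof. by rewrite idxD addrC subrK. Qed.

Lemma image_cellD s g h j :
  image_cell s (g + h) j = image_cell s g (image_cell s h j).
Proof. by rewrite /image_cell positionK -addrA (addrC g). Qed.

(** Addresses biject with all of Z^2, so each stage already carries an exact action, frozen or
    not. *)
Lemma translateD s n g h x :
  translate s n (g + h) x = translate s n g (translate s n h x).
Proof.
rewrite [RHS]/translate idx_translate -image_cellD /translate -addrA -mulrDl.
by rewrite -rmorphD /=; congr (_ + _%:~R / _); ring.
Qed.

Lemma translate0 s n x : translate s n 0 x = x.
Proof. by rewrite /translate /image_cell addr0 addressK subrr mul0r addr0. Qed.

Lemma frozenS bad n v s s' w j (b : bool) : refines bad n v s s' w ->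
  frozen (extent s) j -> frozen (extent s') (2 * j + b%:Z).
Proof. by move=> [_ _ + _ _]; rewrite /frozen; case: b; lia. Qed.

(** Halves on the same side of two frozen cells receive the same increment [w *+ b], so their
    address difference is still [g]. *)
Lemma image_cellS bad n v s s' w g j (b : bool) : refines bad n v s s' w ->
  stable s g j -> image_cell s' g (2 * j + b%:Z) = 2 * image_cell s g j + b%:Z.
Proof.
move=> [_ addrS _ _ _] /andP[Mj Mj']; apply: (can_inj (@addressK s')).
by rewrite positionK !addrS// /image_cell positionK addrAC.
Qed.

Lemma stableS bad n v s s' w g x : refines bad n v s s' w ->
  stable s g (idx n x) -> stable s' g (idx n.+1 x).
Proof.
move=> sw st; have [b ->] := idxS n x; move: (st) => /andP[Mj Mj'].
by rewrite /stable (image_cellS _ sw)// !(frozenS _ sw).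
Qed.

Lemma translateS bad n v s s' w g x : refines bad n v s s' w ->
  stable s g (idx n x) -> translate s' n.+1 g x = translate s n g x.
Proof.
move=> sw st; rewrite /translate; have [b ->] := idxS n x.
rewrite (image_cellS _ sw)// opprD addrACA subrr addr0 -mulrBr rmorphM /=.
by rewrite exprS invfM mulrACA divff ?mul1r.
Qed.

End stage_translation.

(** * The limit action *)

(** Dyadic cells are countable, so those on which [S] is a translation, made disjoint, form a
    partition for [translations_preserve]. *)
Lemma locally_translation_preserve {R : realType} (S S' : R -> R) :
  cancel S S' -> cancel S' S ->
  (forall x : R, exists n j d, cell n j x /\ forall y, cell n j y -> S y = y + d) ->
  measure_preserving (@clm R) (S : lebesgueTypeR R -> lebesgueTypeR R).
Proof.
move=> SK S'K Sloc.
pose c (i : nat) : nat * int := odflt (0%N, 0) (unpickle i).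
(* The displacement is read off at the left endpoint of the cell. *)
pose h i := S ((c i).2%:~R / 2 ^+ (c i).1) - (c i).2%:~R / 2 ^+ (c i).1.
pose Q i : set (lebesgueTypeR R) := [set x | cell (c i).1 (c i).2 x /\
  forall y, cell (c i).1 (c i).2 y -> S y = y + h i].
have mQ i : measurable (Q i).
  have [Ti|nTi] := pselect (forall y, cell (c i).1 (c i).2 y -> S y = y + h i).
    rewrite (_ : Q i = cell (c i).1 (c i).2); first exact: measurable_cell.
    by apply/seteqP; split=> [x []|x ?].
  by rewrite (_ : Q i = set0) //; apply/seteqP; split=> [x []|x ].
apply: (translations_preserve (h := h) (P := seqDU Q) SK S'K).
- move=> i; rewrite /seqDU; apply: measurableD => //.
  by apply: bigsetU_measurable => k _; exact: mQ.
- exact: trivIset_seqDU.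
- rewrite -seqDU_bigcup_eq; apply/seteqP; split=> // x _.
  have [n [j [d [xc Sd]]]] := Sloc x.
  exists (pickle (n, j)) => //; rewrite /Q /h /c /= pickleK /=; split => // y yc.
  have lc : cell n j (j%:~R / 2 ^+ n : R).
    by apply/cellP; rewrite lexx /= ltr_pM2r ?invr_gt0 ?exprn_gt0// ltrDl.
  by rewrite (Sd _ yc) (Sd _ lc) [_ + d - _]addrAC subrr add0r.
- by move=> i x [[xc +] _]; exact.
Qed.

Section tower_action.
Context {R : realType}.
Variables (bad : Z2 -> Prop) (v : nat -> Z2) (s : nat -> stage) (w : nat -> Z2).
Hypothesis s_refines : forall n, refines bad n (v n) (s n) (s n.+1) (w n).

Lemma extent_large n : (n * 2 ^ n <= extent (s n))%N.
Proof.
case: n => // n; have [_ _ + _ _] := s_refines n.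
by apply: leq_trans; rewrite leq_addl.
Qed.

Lemma exists_stable g (x : R) : exists n, stable (s n) g (idx n x).
Proof.
(* Beyond [|x|] the cell of [x] is frozen; beyond [pickle g] the next stage also freezes its
   image. *)
pose n := (Num.bound `|x| + (pickle g).+1)%N.
have Mx : frozen (extent (s n)) (idx n x).
  have p2 : 0 < 2 ^+ n :> R by rewrite exprn_gt0.
  have : `|x * 2 ^+ n| < (extent (s n))%:R.
    rewrite normrM (gtr0_norm p2); apply: (@lt_le_trans _ _ (n * 2 ^ n)%:R).
      rewrite natrM natrX ltr_pM2r//.
      apply: (lt_le_trans (archi_boundP (normr_ge0 x))).
      by rewrite ler_nat leq_addr.
    by rewrite ler_nat extent_large.
  rewrite ltr_norml => /andP[h1 h2].
  by rewrite /frozen /idx floor_ge_int floor_lt_int rmorphN /= (ltW h1).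
exists n.+1; have [b E] := idxS n x; rewrite E.
have gn : (pickle g < n)%N by rewrite /n; lia.
have M2x : frozen (2 * extent (s n)) (2 * idx n x + b%:Z).
  by move: Mx; rewrite /frozen; case: (b); lia.
have [_ _ _ near _] := s_refines n.
by rewrite /stable (frozenS _ (s_refines n) Mx) near.
Qed.

(** All stages stable at [x] give the same value, so the choice by [cid] is immaterial. *)
Definition tower_action (g : Z2) (x : R) : R :=
  translate (s (projT1 (cid (exists_stable g x)))) (projT1 (cid (exists_stable g x))) g x.

Lemma stable_translate_le g (x : R) m n : (m <= n)%N ->
  stable (s m) g (idx m x) ->
  stable (s n) g (idx n x) /\ translate (s n) n g x = translate (s m) m g x.
Proof.
move=> /subnK <-; elim: (n - m)%N => [|k IH] // st.
have [st' E] := IH st; split; first exact: (stableS (s_refines _) st').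
by rewrite -E; exact: (translateS (s_refines _) st').
Qed.

Lemma tower_actionE g (x : R) n : stable (s n) g (idx n x) ->
  tower_action g x = translate (s n) n g x.
Proof.
rewrite /tower_action; case: cid => m /= stm stn.
have [_ <-] := stable_translate_le (leq_maxl m n) stm.
by have [_ <-] := stable_translate_le (leq_maxr m n) stn.
Qed.

Lemma eventually_stable g (x : R) : exists n0, forall n, (n0 <= n)%N ->
  stable (s n) g (idx n x).
Proof.
have [n0 st] := exists_stable g x.
by exists n0 => n nn; have [] := stable_translate_le nn st.
Qed.

(** Both sides can be computed at one late stage, where the law is [translateD]. *)
Lemma tower_action_Z2 : Z2_action tower_action.
Proof.
split=> [x|g h x].
  by have [n st] := exists_stable 0 x; rewrite (tower_actionE st) translate0.
have [n1 st1] := eventually_stable (g + h) x.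
have [n2 st2] := eventually_stable h x.
have [n3 st3] := eventually_stable g (tower_action h x).
pose n := maxn n1 (maxn n2 n3).
have n1n : (n1 <= n)%N by rewrite /n; lia.
have n2n : (n2 <= n)%N by rewrite /n; lia.
have n3n : (n3 <= n)%N by rewrite /n; lia.
rewrite (tower_actionE (st1 _ n1n)) translateD (tower_actionE (st3 _ n3n)).
by rewrite (tower_actionE (st2 _ n2n)).
Qed.

Lemma tower_actionK g : cancel (tower_action g) (tower_action (- g)).
Proof.
have [T0 TD] := tower_action_Z2.
by move=> x; rewrite -TD addNr T0.
Qed.

Lemma tower_actionNK g : cancel (tower_action (- g)) (tower_action g).
Proof. by move=> x; rewrite -{1}(opprK g) tower_actionK. Qed.

Lemma tower_action_image g (A : set R) :
  tower_action g @` A = tower_action (- g) @^-1` A.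
Proof.
apply/seteqP; split=> [_ [x Ax <-]|x Ax]; first by rewrite /= tower_actionK.
by exists (tower_action (- g) x) => //; rewrite tower_actionNK.
Qed.

Lemma tower_action_cell g n j (x : R) : stable (s n) g j -> cell n j x ->
  tower_action g x = x + (image_cell (s n) g j - j)%:~R / 2 ^+ n.
Proof. by move=> st xj; rewrite (@tower_actionE _ _ n) /translate xj. Qed.

Lemma tower_action_preserving g : measure_preserving (@clm R)
  (tower_action g : lebesgueTypeR R -> lebesgueTypeR R).
Proof.
apply: (locally_translation_preserve (@tower_actionK g) (@tower_actionNK g)).
move=> x; have [n st] := exists_stable g x.
exists n, (idx n x), ((image_cell (s n) g (idx n x) - idx n x)%:~R / 2 ^+ n).
by split => // y; exact: tower_action_cell.
Qed.

Lemma measurable_tower_action_image g (A : set (lebesgueTypeR R)) :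
  measurable A -> measurable (tower_action g @` A : set (lebesgueTypeR R)).
Proof.
move=> mA; rewrite tower_action_image.
have [mT _] := tower_action_preserving (- g).
by rewrite -[X in measurable X]setTI; exact: mT.
Qed.

Lemma clm_tower_action_cell g n j (A : set R) : stable (s n) g j ->
  clm (tower_action g @` A `&` cell n (image_cell (s n) g j)) = clm (A `&` cell n j).
Proof.
move=> st; set j' := image_cell _ _ _; set d : R := (j' - j)%:~R / 2 ^+ n.
rewrite -(clm_translate_set d); congr (clm _); apply/seteqP; split=> x.
  move=> [[y Ay yx] xj'].
  have xj : cell n j x.
    by rewrite -(addrK d x) -mulNr -rmorphN /= /cell /= idxD xj'; lia.
  suff xy : y = x by split => //; rewrite -xy.
  by apply: (can_inj (@tower_actionK g)); rewrite yx (tower_action_cell st xj).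
move=> [Ax xj]; split; first by exists x => //; rewrite (tower_action_cell st xj).
by rewrite /translate_set /cell /= idxD xj addrC subrK.
Qed.

(** Passing to equal halves keeps the difference; passing to opposite halves adds [w n] or its
    opposite, which the last clause of [refines] and the symmetry of [bad] keep out of [bad],
    whatever the earlier difference. *)
Lemma address_difference_not_bad n (x y : R) : (0 < extent (s 0))%N ->
  (forall d, bad d -> bad (- d)) -> cell 0 0 x -> cell 0 0 y ->
  [/\ frozen (extent (s n)) (idx n x), frozen (extent (s n)) (idx n y) &
      address (s n) (idx n x) - address (s n) (idx n y) = 0 \/
      ~ bad (address (s n) (idx n x) - address (s n) (idx n y))].
Proof.
move=> s0 badN x0 y0; elim: n => [|n [Mx My IH]].
  by rewrite x0 y0 subrr /frozen; split; [lia|lia|left].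
have [b xE] := idxS n x; have [b' yE] := idxS n y; rewrite xE yE.
have [_ addrS _ _ gap] := s_refines n.
split; [exact: frozenS (s_refines n) Mx|exact: frozenS (s_refines n) My|].
rewrite !addrS// opprD addrACA; case: b b' {xE yE} => -[].
- by rewrite subrr addr0.
- by rewrite subr0; right; exact: gap.
- by rewrite sub0r; right => /badN; rewrite opprD opprB opprK; exact: gap.
- by rewrite subrr addr0.
Qed.

End tower_action.

(** * Overlaps in measure; tunnels of irrational directions *)

(** If [A] and [B] met in a null set, splitting [C] along [B] would leave room for [A] outside [B],
    and the two measures would add up to at most that of [C]. *)
Lemma clm_overlap {R : realType} (A B C : set (lebesgueTypeR R)) : measurable B ->
  (clm C < clm (A `&` C) + clm (B `&` C))%E -> (0 < clm (A `&` B))%E.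
Proof.
move=> mB lt; rewrite lt_neqAle measure_ge0 andbT; apply/eqP => /esym AB0.
have {}mB : ((@wlength R idfun)^*%mu).-caratheodory B := mB.
move: lt; apply/negP; rewrite -leNgt (mB C : clm C = _) addeC setIC.
apply: leeD2l; rewrite (mB (A `&` C) : clm (A `&` C) = _).
rewrite [X in (X + _)%E](_ : _ = 0%E).
  by rewrite add0e; apply: le_outer_measure => x [[]].
apply/eqP; rewrite eq_le outer_measure_ge0 andbT.
suff : (clm (A `&` C `&` B) <= clm (A `&` B))%E by rewrite AB0.
by apply: le_outer_measure => x [[]].
Qed.

(** The left side is the distance from [x] to the line; it is bounded by the distance to any point
    of the line through Lagrange's identity. *)
Lemma tunnel_lt {R : realType} (theta : R) (x : R * R) : tunnel 1 theta x ->
  `|x.1 * sin theta - x.2 * cos theta| < 1.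
Proof.
case: x => a b [t _] /=; rewrite /euclidean_ball /= => h.
have cs := cos2Dsin2 theta.
move: h; set p := a - _; set q := b - _ => h.
have {h} pq : p ^+ 2 + q ^+ 2 < 1.
  rewrite ltNge; apply/negP => /ler_wsqrtr; rewrite sqrtr1.
  by move=> /(lt_le_trans h); rewrite ltxx.
have -> : a * sin theta - b * cos theta = p * sin theta - q * cos theta.
  by rewrite /p /q; ring.
rewrite -(@ltr_pXn2r _ 2)// ?nnegrE// expr1n real_normK ?num_real//.
have : 0 <= (p * cos theta + q * sin theta) ^+ 2 by exact: sqr_ge0.
have -> : (p * cos theta + q * sin theta) ^+ 2 =
  (p ^+ 2 + q ^+ 2) * (cos theta ^+ 2 + sin theta ^+ 2) -
  (p * sin theta - q * cos theta) ^+ 2 by ring.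
by rewrite cs; lra.
Qed.

Lemma tunnelN {R : realType} (eps theta : R) (x : R * R) :
  tunnel eps theta x -> tunnel eps theta (- x).
Proof.
case: x => a b [t _]; rewrite /euclidean_ball /= => h; exists (- t) => //.
rewrite -[- (a, b)]/(- a, - b) /euclidean_ball /=.
by move: h; congr (is_true (Num.sqrt _ < _)); ring.
Qed.

Lemma tunnel_line {R : realType} (eps theta t : R) : 0 < eps ->
  tunnel eps theta (t * cos theta, t * sin theta).
Proof.
move=> e0; exists t => //=.
by rewrite /euclidean_ball /= !subrr expr0n /= addr0 sqrtr0.
Qed.

(** A vanishing cross product would make [v] parallel to the direction, with factor the inner
    product [c]. *)
Lemma irrational_cross_neq0 {R : realType} (theta : R) (v : Z2) :
  irrational_direction theta -> v != 0 ->
  v.1%:~R * sin theta - v.2%:~R * cos theta != 0.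
Proof.
move=> [dir irr] v0; apply/eqP => cross; apply: irr; split=> //.
have cs := cos2Dsin2 theta.
pose c := v.1%:~R * cos theta + v.2%:~R * sin theta.
have c1 : c * cos theta = v.1%:~R.
  transitivity (v.1%:~R * (cos theta ^+ 2 + sin theta ^+ 2) -
    sin theta * (v.1%:~R * sin theta - v.2%:~R * cos theta)); first by rewrite /c; ring.
  by rewrite cs cross; ring.
have c2 : c * sin theta = v.2%:~R.
  transitivity (v.2%:~R * (cos theta ^+ 2 + sin theta ^+ 2) +
    cos theta * (v.1%:~R * sin theta - v.2%:~R * cos theta)); first by rewrite /c; ring.
  by rewrite cs cross; ring.
exists c; split; last by exists v.
apply: contraNneq v0 => c0; move: c1 c2; rewrite c0 !mul0r.
move=> /esym/eqP; rewrite intr_eq0 => /eqP v1 /esym/eqP; rewrite intr_eq0 => /eqP v2.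
by case: v v1 v2 {cross c c0} => a b /= -> ->.
Qed.

Section bad_translations.
Context {R : realType}.
Variables (k : nat) (alpha : 'I_k -> R).

(** The clause [d = 0] makes 0 bad even when [k = 0]. *)
Definition in_tunnels (d : Z2) : Prop :=
  d = 0 \/ exists i, tunnel 1 (alpha i) (d.1%:~R, d.2%:~R).

Lemma in_tunnelsN d : in_tunnels d -> in_tunnels (- d).
Proof.
case=> [->|[i di]]; first by left; rewrite oppr0.
by right; exists i; rewrite /= !rmorphN; exact: tunnelN di.
Qed.

Lemma escapes_tunnels : (forall i, irrational_direction (alpha i)) ->
  escapes in_tunnels.
Proof.
move=> irr v v0 D.
have [L LP] : exists L : nat, forall d : Z2, d \in D -> (`|d.1| + `|d.2| <= L)%N.
  elim: D => [|d D [L LP]]; first by exists 0%N.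
  exists (L + `|d.1| + `|d.2|)%N => e.
  rewrite inE -addnA => /predU1P[->|/LP/leq_trans->//]; first exact: leq_addl.
  exact: leq_addr.
pose K i := v.1%:~R * sin (alpha i) - v.2%:~R * cos (alpha i).
have [c cP] : exists c : nat, (L <= c)%N /\ forall i, (1 + L%:R) / `|K i| <= c%:R.
  (* The summand [L] prevents [d + v *+ c.+1] from vanishing; the others bring its cross product
     with each direction to at least 1. *)
  exists (L + \sum_i Num.bound ((1 + L%:R) / `|K i|))%N; split=> [|i].
    by rewrite leq_addr.
  have /archi_boundP/ltW/le_trans : 0 <= (1 + L%:R) / `|K i|.
    by rewrite divr_ge0// addr_ge0.
  by apply; rewrite ler_nat (bigD1 i)//= addnCA leq_addr.
case: cP => Lc Kc.
exists c => d /LP dL; have vc1 : (v *+ c.+1).1 = v.1 * c.+1%:Z.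
  by rewrite (raddfMn (@fst int int)) /= -mulr_natr natz.
have vc2 : (v *+ c.+1).2 = v.2 * c.+1%:Z.
  by rewrite (raddfMn (@snd int int)) /= -mulr_natr natz.
case=> [/eqP|[i]].
  rewrite addr_eq0 => /eqP dE; have d1 : d.1 = - (v.1 * c.+1%:Z) by rewrite -vc1 dE.
  have d2 : d.2 = - (v.2 * c.+1%:Z) by rewrite -vc2 dE.
  case: (v) v0 d1 d2 => a b /= ab d1 d2.
  have [a0|a0] := eqVneq a 0; last by nia.
  have [b0|b0] := eqVneq b 0; last by nia.
  by move: ab; rewrite a0 b0 eqxx.
move=> /tunnel_lt /=; rewrite vc1 vc2 !rmorphD !rmorphM /=; apply/negP; rewrite -leNgt.
set sn := sin _; set cs := cos _.
have sn1 : `|sn| <= 1 by rewrite ler_norml sin_geN1 sin_le1.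
have cs1 : `|cs| <= 1 by rewrite ler_norml cos_geN1 cos_le1.
have K0 : 0 < `|K i| by rewrite normr_gt0 irrational_cross_neq0.
have dL' : `|d.1%:~R * sn - d.2%:~R * cs| <= L%:R.
  apply: (le_trans (ler_normB _ _)); rewrite !normrM.
  apply: (@le_trans _ _ (`|d.1%:~R| + `|d.2%:~R|)); first by rewrite lerD// ler_piMr.
  by rewrite -!intr_norm -rmorphD /= -[L%:R]/(L%:~R) ler_int; lia.
have cK : 1 + L%:R <= `|c.+1%:R * K i|.
  rewrite normrM normr_nat -ler_pdivrMr//; apply: (le_trans (Kc i)).
  by rewrite ler_nat.
have -> : (d.1%:~R + v.1%:~R * c.+1%:R) * sn - (d.2%:~R + v.2%:~R * c.+1%:R) * cs =
    c.+1%:R * K i + (d.1%:~R * sn - d.2%:~R * cs) by rewrite /K -/sn -/cs; ring.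
have := lerB_dist (c.+1%:R * K i) (- (d.1%:~R * sn - d.2%:~R * cs)).
by rewrite opprK normrN; lra.
Qed.

End bad_translations.

(** * The measure space, ergodicity and return vectors *)

Lemma clmT {R : realType} : clm [set: R] = +oo%E.
Proof.
rewrite -set_itvNyy; transitivity (@lebesgue_measure R `]-oo, +oo[%classic) => //.
by rewrite lebesgue_measure_itv.
Qed.

Lemma lebesgue_space_clm {R : realType} : lebesgue_space (@clm R).
Proof.
split; first exact: completed_lebesgue_measure_is_complete.
exists set0, setT, `]-oo, +oo[, setT, id; rewrite set_itvNyy.
split.
- exact: countable0.
- by [].
- by split=> //; rewrite ?setI0// setU0 setCT measure0.
- by split=> //; rewrite setDv measure0.
- by split=> [|A _|A _ _]; rewrite ?image_id//; split=> //; exact: image_id.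
Qed.

Section tower_properties.
Context {R : realType}.
Variables (bad : Z2 -> Prop) (v : nat -> Z2) (s : nat -> stage) (w : nat -> Z2).
Hypothesis s_refines : forall n, refines bad n (v n) (s n) (s n.+1) (w n).

Let T : Z2 -> lebesgueTypeR R -> lebesgueTypeR R := tower_action s_refines.

Lemma dense_frozen_cell (A : set R) : (0 < clm A)%E ->
  exists n0, forall n, (n0 <= n)%N -> exists2 j, frozen (extent (s n)) j &
    ((3 / 4 / 2 ^+ n)%:E < clm (A `&` cell n j))%E.
Proof.
move=> /dense_cell[k [n0 n0P]]; exists (maxn k n0) => n; rewrite geq_max.
move=> /andP[kn /n0P[j jk dj]]; exists j => //.
have := extent_large s_refines n.
have : (k * 2 ^ n <= n * 2 ^ n)%N by rewrite leq_mul2r kn orbT.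
by move: jk; rewrite /frozen; lia.
Qed.

(** At a common level, [g] carries a cell mostly in [A] onto one mostly in its complement; as 3/4 +
    3/4 > 1, the image of [A] meets the complement. *)
Lemma tower_action_ergodic : ergodic_action (@clm R) T.
Proof.
move=> A mA TA.
have [A0|A0] := eqVneq (clm A) 0%E; first by left.
have [CA0|CA0] := eqVneq (clm (~` A)) 0%E; first by right.
exfalso.
have /dense_frozen_cell[n1 n1P] : (0 < clm A)%E by rewrite lt0e A0 measure_ge0.
have /dense_frozen_cell[n2 n2P] : (0 < clm (~` A))%E by rewrite lt0e CA0 measure_ge0.
pose n := maxn n1 n2.
have [j Mj Aj] := n1P n (leq_maxl _ _).
have [j' Mj' CAj'] := n2P n (leq_maxr _ _).
pose g := address (s n) j' - address (s n) j.
have gE : image_cell (s n) g j = j' by rewrite /image_cell /g addrC subrK addressK.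
have st : stable (s n) g j by rewrite /stable gE Mj.
suff : (0 < clm (T g @` A `&` ~` A))%E.
  move=> TACA; have := TA g; apply/eqP; rewrite gt_eqF//.
  by apply: (lt_le_trans TACA); apply: le_outer_measure => x [? ?]; right.
apply: (@clm_overlap _ _ _ (cell n j')); first exact: measurableC.
rewrite clm_cell -{1}gE clm_tower_action_cell//.
apply: (lt_trans _ (lteD Aj CAj')); rewrite -EFinD lte_fin.
have : 0 < (2 ^+ n)^-1 :> R by rewrite invr_gt0 exprn_gt0.
lra.
Qed.

(** In a dense cell, [w n] brings the left part of [A] into the right half; with the right part of
    [A] this exceeds 3/4 of the cell inside half of it, so the two overlap. *)
Lemma tower_action_return (A : set (lebesgueTypeR R)) : measurable A ->
  (0 < clm A)%E -> exists n0, forall n, (n0 <= n)%N ->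
  (0 < clm (A `&` T (w n) @` A))%E.
Proof.
move=> mA /dense_frozen_cell[n0 n0P]; exists n0 => n /n0P[j Mj].
have [_ addressS _ _ _] := s_refines n.
have E : image_cell (s n.+1) (w n) (2 * j) = 2 * j + 1.
  apply: (can_inj (@addressK (s n.+1))); rewrite /image_cell positionK.
  by rewrite (addressS j true)// -[2 * j]addr0 (addressS j false)// addr0.
have st : stable (s n.+1) (w n) (2 * j).
  rewrite /stable E -{1}[2 * j]addr0.
  by rewrite (frozenS false (s_refines n) Mj) (frozenS true (s_refines n) Mj).
have half : (clm (A `&` cell n j) <=
    clm (A `&` cell n.+1 (2 * j)) + clm (A `&` cell n.+1 (2 * j + 1)))%E.
  apply: le_trans (outer_measureU2 _ _ _); apply: le_outer_measure => x [Ax xj].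
  have [[] ] := idxS n x; rewrite xj ?addr0 => xb; first by right.
  by left.
have leC i : (clm (A `&` cell n.+1 i) <= ((2 ^+ n.+1)^-1)%:E)%E.
  by rewrite -(clm_cell n.+1 i); apply: le_outer_measure; exact: subIsetr.
move=> /lt_le_trans/(_ half) gt.
apply: (@clm_overlap _ _ _ (cell n.+1 (2 * j + 1))).
  exact: measurable_tower_action_image.
rewrite clm_cell -{2}E clm_tower_action_cell//.
have fin i : clm (A `&` cell n.+1 i) \is a fin_num.
  by rewrite ge0_fin_numE ?outer_measure_ge0// (le_lt_trans (leC i)) ?ltry.
move: gt (leC (2 * j)) (leC (2 * j + 1)).
rewrite -(fineK (fin (2 * j))) -(fineK (fin (2 * j + 1))) -!EFinD !lte_fin !lee_fin.
rewrite exprS invfM; set q := (2 ^+ n)^-1; lra.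
Qed.

End tower_properties.

(** * Excluded return vectors and conclusion *)

(** At a stable stage [g] is the difference of the addresses of two points of the unit cell. *)
Lemma in_tunnels_not_return {R : realType} (k : nat) (alpha : 'I_k -> R)
    (v : nat -> Z2) (s : nat -> stage) (w : nat -> Z2)
    (s_refines : forall n, refines (in_tunnels alpha) n (v n) (s n) (s n.+1) (w n))
    (g : Z2) (x : R) :
  (0 < extent (s 0))%N -> cell 0 0 x -> cell 0 0 (tower_action s_refines g x) ->
  g = 0 \/ ~ in_tunnels alpha g.
Proof.
move=> s0 x0 gx0; have [n st] := exists_stable s_refines g x.
have [_ _] := address_difference_not_bad s_refines n s0 (@in_tunnelsN _ _ alpha) gx0 x0.
rewrite (tower_actionE s_refines st) idx_translate /image_cell positionK.
by rewrite addrAC subrr add0r.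
Qed.

Theorem theorem1p5 (R : realType) (k : nat) (alpha : 'I_k -> R)
    (alpha_irr : forall i, irrational_direction (alpha i)) :
  exists (d : measure_display) (X : measurableType d)
    (mu : {measure set X -> \bar R}) (T : Z2 -> X -> X),
    [/\ sigma_finite [set: X] mu /\ lebesgue_space mu,
        infinite_measure_preserving_action mu T,
        recurrent_action mu T,
        ergodic_action mu T &
        [set theta : R | rational_direction theta]
          `<=` recurrent_directions mu T /\
        (forall i, ~ recurrent_directions mu T (alpha i))].
Proof.
have bad0 : in_tunnels alpha 0 by left.
have [s [w [s0 sw]]] := exists_tower bad0 (escapes_tunnels alpha_irr).
pose T : Z2 -> lebesgueTypeR R -> lebesgueTypeR R := tower_action sw.
have rat_rec : [set theta : R | rational_direction theta] `<=`
    recurrent_directions (@clm R) T.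
  move=> theta [dir [c [c0 [v [v1 v2]]]]]; split=> // eps eps0 A mA A0.
  have v0 : v != 0.
    apply: contraNneq c0 => v0; move: v1 v2; rewrite v0 /= => v1 v2.
    have := cos2Dsin2 theta => cs.
    have : c ^+ 2 * (cos theta ^+ 2 + sin theta ^+ 2) = 0.
      by rewrite mulrDr -!exprMn v1 v2 !expr0n addr0.
    by rewrite cs mulr1 => /eqP; rewrite sqrf_eq0.
  have [n0 n0P] := tower_action_return sw mA A0.
  have [n nn vn] := visit_recurrent n0 v0.
  have [[m wE] _ _ _ _] := sw n; rewrite vn in wE.
  have w1 : (w n).1 = v.1 * m.+1%:Z.
    by rewrite wE (raddfMn (@fst int int)) /= -mulr_natr natz.
  have w2 : (w n).2 = v.2 * m.+1%:Z.
    by rewrite wE (raddfMn (@snd int int)) /= -mulr_natr natz.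
  exists (w n); split; last exact: n0P.
    apply: contraNneq v0 => w0; move: w1 w2; rewrite w0 /=.
    move=> /esym/eqP; rewrite mulf_eq0 orbF => /eqP a0.
    move=> /esym/eqP; rewrite mulf_eq0 orbF => /eqP b0.
    by case: v a0 b0 {v1 v2 vn wE} => a b /= -> ->.
  (* A multiple of [v] lies on the line itself, hence in every tunnel. *)
  rewrite w1 w2 (rmorphM _ v.1) (rmorphM _ v.2) /= -v1 -v2.
  by rewrite (mulrAC c (cos _)) (mulrAC c (sin _)); exact: tunnel_line.
exists _, (lebesgueTypeR R), (@clm R), T; split.
- split; last exact: lebesgue_space_clm.
  exact: sigma_finiteT.
- split; [exact: tower_action_Z2|exact: tower_action_preserving|exact: clmT].
- move=> A mA A0.
  (* Recurrence of the action follows from that of the rational direction 0. *)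
  have [|_ /(_ 1 ltr01 A mA A0)[n [n0 _ An]]] := rat_rec 0; last by exists n.
  split; first by rewrite /direction lexx pi_gt0.
  by exists 1; split => //; exists (1, 0); rewrite cos0 sin0 !mul1r.
- exact: tower_action_ergodic.
(* The set [[0, 1[] and tunnel width 1 refute recurrence of [alpha i]. *)
- split=> // i [_ /(_ 1 ltr01 (cell 0 0) (measurable_cell 0 0))].
  have cell_gt0 : (0 < clm (@cell R 0 0))%E by rewrite clm_cell expr0 invr1 lte_fin.
  move=> /(_ cell_gt0)[g [g0 gi]].
  apply/negP; rewrite -leNgt (_ : _ `&` _ = set0) ?measure0//.
  apply/seteqP; split=> // y [+ [x x0 xE]]; rewrite -xE => gx0.
  have [gE|[]] := in_tunnels_not_return s0 x0 gx0; first by rewrite gE eqxx in g0.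
  by right; exists i.
Qed.
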